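(* Let $\bar A=\{A_1,\dots,A_{8g-4}\}$ be any partition with $A_i\in(P_i,Q_i)$ for every $i$. Then each partition point $A_i$, $1\le i\le 8g-4$, satisfies the cycle property: there exist positive integers $m_i,k_i$ such that \[ f_{\bar A}^{m_i}(T_iA_i)=f_{\bar A}^{k_i}(T_{i-1}A_i). \]
   Context: Setting. Fix $g\ge 2$. Work in the Poincaré unit disk $\mathbb D$ with hyperbolic metric $2|dz|/(1-|z|^2)$; let $\mathbb S$ be the unit circle. Let $\mathcal F$ be the regular hyperbolic $(8g-4)$-gon centered at $0$ with all interior angles equal to $\pi/2$; it is a fundamental domain (Adler–Flatto) of a cocompact torsion-free Fuchsian group $\Gamma$ of genus $g$. All indices are taken mod $8g-4$. Label the sides of $\mathcal F$ by $1,\dots,8g-4$ counterclockwise and the vertices $V_1,\dots,V_{8g-4}$ so that side $i$ joins $V_i$ to $V_{i+1}$. The complete geodesic extending side $i$ is oriented from its endpoint $P_i\in\mathbb S$ (beyond $V_i$) to its endpoint $Q_{i+1}\in\mathbb S$ (beyond $V_{i+1}$); the points on $\mathbb S$ are in the counterclockwise order $P_1,Q_1,P_2,Q_2,\dots,P_{8g-4},Q_{8g-4}$. Define $\sigma(i)=4g-i$ for odd $i$ and $\sigma(i)=2-i$ for even $i$ (mod $8g-4$), $\rho(i)=\sigma(i)+1$, $\theta(i)=\sigma(i)-1$. The generators $T_1,\dots,T_{8g-4}$ of $\Gamma$ are the Möbius transformations of $\mathbb D$ with $T_i$ mapping side $i$ onto side $\sigma(i)$, whose isometric circle is the geodesic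 $P_iQ_{i+1}$; $T_i$ maps the geodesic $P_iQ_{i+1}$ onto the geodesic $Q_{\sigma(i)+1}P_{\sigma(i)}$ (the isometric circle of $T_{\sigma(i)}$), the inside of the former to the outside of the latter, and $T_{\sigma(i)}T_i=\mathrm{Id}$, $T_i(V_i)=V_{\rho(i)}$, $T_{\rho^3(i)}T_{\rho^2(i)}T_{\rho(i)}T_i=\mathrm{Id}$. Notation: for $A,B\in\mathbb S$, $[A,B]$, $(A,B]$, $[A,B)$, $(A,B)$ denote arcs of $\mathbb S$ from $A$ to $B$ in the counterclockwise direction. Boundary map: for a partition $\bar A=\{A_1,\dots,A_{8g-4}\}$ with $A_i\in(P_i,Q_i)$, define $f_{\bar A}:\mathbb S\to\mathbb S$ by $f_{\bar A}(x)=T_i(x)$ if $x\in[A_i,A_{i+1})$. Convention for the orbits $\{f^n_{\bar A}(T_iA_i)\}$ and $\{f^n_{\bar A}(T_{i-1}A_i)\}$: if the orbit of $T_{i-1}A_i$ hits a discontinuity point $A_j$, the next iterate is $T_{j-1}A_j$; if the orbit of $T_iA_i$ hits $A_j$, the next iterate is $T_jA_j$. *)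

(* Defs.v *)
From Stdlib Require Import Reals ZArith ClassicalEpsilon.
From Coquelicot Require Import Coquelicot.
Open Scope R_scope.

(* Number of sides N = 8g-4; indices are integers, read modulo N. *)
Definition Nsides (g : nat) : Z := (8 * Z.of_nat g - 4)%Z.

Definition cis (t : R) : C := (cos t, sin t).

(* direction of the Euclidean center of the (circle of the) geodesic of side i *)
Definition alpha (g : nat) (i : Z) : R := 2 * PI * IZR i / IZR (Nsides g).

(* half-angular width beta of each side geodesic: cos beta = sqrt(cos(2pi/N))
   (this is exactly the condition that adjacent sides meet at angle pi/2) *)
Definition cosb (g : nat) : R := sqrt (cos (2 * PI / IZR (Nsides g))).
Definition sinb (g : nat) : R := sqrt (1 - cos (2 * PI / IZR (Nsides g))).

(* endpoints on the unit circle: side i geodesic runs from P_i (angle alpha_i - beta)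
   to Q_{i+1} (angle alpha_i + beta) *)
Definition Ppt (g : nat) (i : Z) : C := Cmult (cis (alpha g i)) (cosb g, - sinb g).
Definition Qpt (g : nat) (i : Z) : C := Cmult (cis (alpha g (i - 1))) (cosb g, sinb g).

(* side pairing sigma (mod N) *)
Definition sigma (g : nat) (i : Z) : Z :=
  if Z.odd i then (4 * Z.of_nat g - i)%Z else (2 - i)%Z.

(* Euclidean center c_i and squared radius of the isometric circle P_i Q_{i+1} *)
Definition ctr (g : nat) (i : Z) : C := Cmult (RtoC (/ cosb g)) (cis (alpha g i)).
Definition rad2 (g : nat) : R := / (cosb g * cosb g) - 1.

(* T_i = (reflection in the line through 0 exchanging c_i and c_sigma(i))
         o (inversion in the isometric circle of side i):
   T_i z = e^{i(alpha_i + alpha_sigma(i))} (conj c_i + r^2 / (z - c_i)).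
   It maps P_i -> Q_{sigma(i)+1}, Q_{i+1} -> P_{sigma(i)}, inside of the
   isometric circle to the outside of that of T_{sigma(i)}. *)
Definition Tgen (g : nat) (i : Z) (z : C) : C :=
  Cmult (cis (alpha g i + alpha g (sigma g i)))
        (Cplus (Cconj (ctr g i)) (Cdiv (RtoC (rad2 g)) (Cminus z (ctr g i)))).

Definition arc_oo (a b x : C) : Prop :=
  exists tb tx, 0 < tb < 2 * PI /\ 0 < tx < tb /\ b = Cmult a (cis tb) /\ x = Cmult a (cis tx).
Definition arc_co (a b x : C) : Prop :=
  exists tb tx, 0 < tb < 2 * PI /\ 0 <= tx < tb /\ b = Cmult a (cis tb) /\ x = Cmult a (cis tx).
Definition arc_oc (a b x : C) : Prop :=
  exists tb tx, 0 < tb < 2 * PI /\ 0 < tx <= tb /\ b = Cmult a (cis tb) /\ x = Cmult a (cis tx).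

(* The boundary map f_A: f_A(x) = T_j x for x in [A_j, A_{j+1}).
   Its iterates are the orbit convention for T_i A_i. *)
Definition fA (g : nat) (A : Z -> C) (x : C) : C :=
  epsilon (inhabits x) (fun y => exists j : Z, arc_co (A j) (A (j + 1)%Z) x /\ y = Tgen g j x).

(* Variant f_A^- : T_j x for x in (A_j, A_{j+1}]; it agrees with f_A except at
   partition points A_j, where it gives T_{j-1} A_j.  Its iterates are the
   orbit convention for T_{i-1} A_i. *)
Definition fA_minus (g : nat) (A : Z -> C) (x : C) : C :=
  epsilon (inhabits x) (fun y => exists j : Z, arc_oc (A j) (A (j + 1)%Z) x /\ y = Tgen g j x).

(* Main.v *)
(** In the angle x measured from the centre of side j, the two overshooting moves
    are increasing real functions on the interval I = (-beta, beta - step) of the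
    arc (P_j, Q_j): [upper] repels from the right end of I, its mirror image
    [lower] from the left end. Because T_{sigma(j)+1} T_j = T_{sigma(j-1)-1} T_{j-1},
    as long as the two orbits have not met they sit at T_j z and T_{j-1} z for some
    z in (P_j, Q_j), and exactly one of them overshoots its partition point. An
    upper overshoot leads to x >= a_j at the new index j, a lower one to x <= a_j.

    If the orbits never meet, this goes on forever. On indices the moves are the
    involutions j |-> c_U - j and j |-> c_L - j, and neither move can be repeated
    forever. Since A_j separates upper arrivals from lower ones, an index cannot be
    crossed both from an upper to a lower move and from a lower to an upper one.
    Hence the run never turns back along the orbit of indices under the two
    involutions; as c_U - c_L is 4 times a unit modulo 2g - 1, it ends up crossing
    some index in the forbidden direction. *)

From Stdlib Require Import Reals ZArith Lra Lia ClassicalEpsilon.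
From Coquelicot Require Import Coquelicot.
Require Import Defs.
Open Scope R_scope.

(** * Angles on the unit circle *)

Lemma epsilon_unique (T : Type) (i : inhabited T) (P : T -> Prop) (v : T) :
  P v -> (forall y, P y -> y = v) -> epsilon i P = v.
Proof. intros Hv Hu. apply Hu, epsilon_spec. now exists v. Qed.

Lemma cis_add (s t : R) : cis (s + t) = Cmult (cis s) (cis t).
Proof.
  unfold cis, Cmult; simpl. rewrite cos_plus, sin_plus. f_equal; ring.
Qed.

Lemma cis_neq_0 (t : R) : cis t <> 0%C.
Proof.
  unfold cis. intros H. injection H as H1 H2.
  pose proof (sin2_cos2 t) as H. rewrite H1, H2 in H. unfold Rsqr in H. lra.
Qed.

Lemma cis_2PI_mult (m : Z) : cis (2 * PI * IZR m) = 1%C.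
Proof.
  unfold cis.
  assert (Hs : sin (IZR m * PI) = 0) by (apply sin_eq_0_1; now exists m).
  replace (2 * PI * IZR m) with (2 * (IZR m * PI)) by ring.
  rewrite cos_2a_sin, sin_2a, Hs. unfold RtoC. f_equal; ring.
Qed.

Lemma cis_add_2PI_mult (t : R) (m : Z) : cis (t + 2 * PI * IZR m) = cis t.
Proof. rewrite cis_add, cis_2PI_mult. apply Cmult_1_r. Qed.

Lemma cis_eq (s t : R) : cis s = cis t -> exists m : Z, s = t + 2 * PI * IZR m.
Proof.
  unfold cis. intros H. injection H as Hc Hs.
  assert (H1 : cos (s - t) = 1).
  { rewrite cos_minus, Hc, Hs. pose proof (sin2_cos2 t) as H. unfold Rsqr in H. lra. }
  replace (s - t) with (2 * ((s - t) / 2)) in H1 by field.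
  rewrite cos_2a_sin in H1.
  assert (H2 : sin ((s - t) / 2) = 0) by nra.
  apply sin_eq_0_0 in H2 as [m Hm]. exists m. lra.
Qed.

Lemma cis_inj (s t : R) : -(2 * PI) < s - t < 2 * PI -> cis s = cis t -> s = t.
Proof.
  intros Hr H. apply cis_eq in H as [m Hm].
  pose proof PI_RGT_0.
  assert (-1 < IZR m < 1) by (split; nra).
  assert (m = 0%Z) by (assert (-1 < m < 1)%Z by (split; apply lt_IZR; lra); lia).
  subst m. lra.
Qed.

Lemma Cmult_cancel_l (z u v : C) : z <> 0%C -> (z * u = z * v)%C -> u = v.
Proof.
  intros Hz H.
  rewrite <- (Cmult_1_l u), <- (Cmult_1_l v), <- (Cinv_l z Hz), <- !Cmult_assoc.
  now rewrite H.
Qed.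

(** With [C0] = 1/c this keeps the denominators z - c_i of the generators nonzero on the circle. *)
Lemma cis_sub_RtoC_neq_0 (t C0 : R) : 1 < C0 -> (cis t - RtoC C0)%C <> 0%C.
Proof.
  intros HC H. unfold cis, Cminus, Cplus, Copp, RtoC in H; simpl in H.
  injection H as H1 _. pose proof (COS_bound t). lra.
Qed.

(** * The circle homeomorphism induced by a generator *)

Definition step (g : nat) : R := 2 * PI / IZR (Nsides g).
Definition beta (g : nat) : R := acos (cosb g).

(* In the angle measured from the centre of side [i] (source) and of side
   [sigma i] (target), every [T_i] acts on the circle by this function. *)
Definition gen_angle (g : nat) (x : R) : R :=
  PI + 2 * atan ((1 + cosb g) / (1 - cosb g) * tan (x / 2)).

Section Geometry.

Variables (g : nat) (hg : (2 <= g)%nat).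

Local Notation N := (Nsides g).
Local Notation d := (step g).
Local Notation b := (beta g).
Local Notation c := (cosb g).
Local Notation F := (gen_angle g).

Lemma Nsides_ge : (12 <= N)%Z.
Proof. unfold Nsides. lia. Qed.

Lemma step_mul_N : d * IZR N = 2 * PI.
Proof.
  pose proof (IZR_le _ _ Nsides_ge). unfold step. field. lra.
Qed.

Lemma step_bounds : 0 < d <= PI / 6.
Proof.
  pose proof (IZR_le _ _ Nsides_ge). pose proof step_mul_N. pose proof PI_RGT_0.
  split; nra.
Qed.

Lemma cos_step_bounds : 1 / 2 < cos d < 1.
Proof.
  pose proof step_bounds. pose proof PI_RGT_0. split.
  - rewrite <- cos_PI3. apply cos_decreasing_1; lra.
  - rewrite <- cos_0. apply cos_decreasing_1; lra.
Qed.

Lemma cosb_sqr : c * c = cos d.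
Proof. pose proof cos_step_bounds. unfold cosb, step in *. apply sqrt_sqrt. lra. Qed.

Lemma cosb_bounds : 0 < c < 1.
Proof.
  pose proof cos_step_bounds. pose proof cosb_sqr.
  assert (0 < c) by (apply sqrt_lt_R0; fold d; lra). split; nra.
Qed.

Lemma cos_beta : cos b = c.
Proof. pose proof cosb_bounds. apply cos_acos. lra. Qed.

Lemma sin_beta : sin b = sinb g.
Proof.
  pose proof cosb_bounds. unfold beta. rewrite sin_acos by lra.
  unfold Rsqr. rewrite cosb_sqr. reflexivity.
Qed.

Lemma beta_bounds : d / 2 < b < d.
Proof.
  pose proof cosb_bounds as Hc. pose proof cosb_sqr as Hc2.
  pose proof step_bounds as Hd. pose proof PI_RGT_0.
  pose proof cos_step_bounds as Hcd.
  pose proof (acos_bound c) as Hb. fold b in Hb.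
  assert (Hh : 0 < cos (d / 2)) by (apply cos_gt_0; lra).
  assert (H2 : cos d = 2 * cos (d / 2) * cos (d / 2) - 1)
    by (rewrite <- cos_2a_cos; f_equal; field).
  pose proof (COS_bound (d / 2)).
  assert (cos (d / 2) < 1) by (rewrite <- cos_0; apply cos_decreasing_1; lra).
  split.
  - apply cos_decreasing_0; try lra. rewrite cos_beta. nra.
  - apply cos_decreasing_0; try lra. rewrite cos_beta. nra.
Qed.

Lemma gen_angle_range (x : R) : 0 < F x < 2 * PI.
Proof.
  unfold gen_angle. pose proof (atan_bound ((1 + c) / (1 - c) * tan (x / 2))). lra.
Qed.

Lemma gen_angle_increasing (x y : R) : - PI < x -> x < y -> y < PI -> F x < F y.
Proof.
  intros Hx Hxy Hy. unfold gen_angle.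
  pose proof cosb_bounds.
  assert (0 < (1 + c) / (1 - c)) by (apply Rdiv_lt_0_compat; lra).
  assert (tan (x / 2) < tan (y / 2)) by (apply tan_increasing; lra).
  assert (atan ((1 + c) / (1 - c) * tan (x / 2)) < atan ((1 + c) / (1 - c) * tan (y / 2))).
  { apply atan_increasing. now apply Rmult_lt_compat_l. }
  lra.
Qed.

(** As a function of y/2 the left side is a sinusoid vanishing at y = [F x], so its sign locates y
    relative to [F x]. Claims about the arctangent formula thus become trigonometric ones. *)
Lemma gen_angle_factor (x : R) : - PI < x < PI ->
  exists p, 0 < p /\ forall y,
    cos ((y - x) / 2) - c * cos ((y + x) / 2) = p * sin ((F x - y) / 2).
Proof.
  intros Hx. pose proof cosb_bounds as Hc.
  assert (Hcx : 0 < cos (x / 2)) by (apply cos_gt_0; lra).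
  set (v := (1 + c) / (1 - c) * tan (x / 2)).
  assert (Hv : (1 + c) * sin (x / 2) = v * ((1 - c) * cos (x / 2))).
  { unfold v, tan. field. lra. }
  pose proof (atan_bound v) as Hav.
  assert (Hcv : 0 < cos (atan v)) by (apply cos_gt_0; lra).
  assert (Hs : sin (atan v) = v * cos (atan v)).
  { rewrite <- (tan_atan v) at 2. unfold tan. field. lra. }
  exists ((1 - c) * cos (x / 2) / cos (atan v)). split.
  { apply Rdiv_lt_0_compat; [nra | lra]. }
  intros y.
  replace ((F x - y) / 2) with (PI / 2 + (atan v - y / 2))
    by (unfold gen_angle; fold v; field).
  rewrite <- cos_sin, cos_minus, Hs.
  replace ((y - x) / 2) with (y / 2 - x / 2) by field.
  replace ((y + x) / 2) with (y / 2 + x / 2) by field.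
  rewrite cos_minus, cos_plus.
  transitivity ((1 - c) * cos (x / 2) * cos (y / 2) + sin (y / 2) * ((1 + c) * sin (x / 2)));
    [ring | rewrite Hv; field; lra].
Qed.

Lemma gen_angle_cos (x : R) : - PI < x < PI ->
  cos ((F x - x) / 2) = c * cos ((F x + x) / 2).
Proof.
  intros Hx. destruct (gen_angle_factor x Hx) as [p [_ Hp]].
  specialize (Hp (F x)). replace ((F x - F x) / 2) with 0 in Hp by field.
  rewrite sin_0 in Hp. lra.
Qed.

Lemma gen_angle_lt (x y : R) : - PI < x < PI -> 0 < y < 2 * PI ->
  cos ((y - x) / 2) < c * cos ((y + x) / 2) -> F x < y.
Proof.
  intros Hx Hy H. destruct (gen_angle_factor x Hx) as [p [Hp0 Hp]].
  specialize (Hp y). pose proof (gen_angle_range x).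
  apply Rnot_le_lt. intros Hle.
  assert (0 <= sin ((F x - y) / 2)) by (apply sin_ge_0; lra). nra.
Qed.

Lemma gen_angle_eq (x y : R) : - PI < x < PI -> 0 < y < 2 * PI ->
  cos ((y - x) / 2) = c * cos ((y + x) / 2) -> F x = y.
Proof.
  intros Hx Hy H. destruct (gen_angle_factor x Hx) as [p [Hp0 Hp]].
  specialize (Hp y). pose proof (gen_angle_range x).
  assert (Hs : sin ((F x - y) / 2) = 0) by nra.
  apply sin_eq_0_0 in Hs as [k Hk]. pose proof PI_RGT_0.
  assert (-1 < IZR k < 1) by (split; nra).
  assert (k = 0%Z) by (assert (-1 < k < 1)%Z by (split; apply lt_IZR; lra); lia).
  subst k. lra.
Qed.

Lemma gen_angle_opp (x : R) : F (- x) = 2 * PI - F x.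
Proof.
  unfold gen_angle. replace (- x / 2) with (- (x / 2)) by field.
  rewrite tan_neg, <- Ropp_mult_distr_r, atan_opp. ring.
Qed.

Lemma gen_angle_P : F (- b) = b.
Proof.
  pose proof beta_bounds. pose proof step_bounds. pose proof PI_RGT_0.
  apply gen_angle_eq; try lra.
  replace ((b - - b) / 2) with b by field. replace ((b + - b) / 2) with 0 by field.
  rewrite cos_0, cos_beta. ring.
Qed.

(** In angles, T_j sends Q_j to Q_{sigma(j)+2}; this rests on the right-angle condition cos d =
    c^2. *)
Lemma gen_angle_Q : F (b - d) = b + d.
Proof.
  pose proof beta_bounds. pose proof step_bounds. pose proof PI_RGT_0.
  apply gen_angle_eq; try lra.
  replace ((b + d - (b - d)) / 2) with d by field.
  replace ((b + d + (b - d)) / 2) with b by field.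
  rewrite cos_beta, cosb_sqr. reflexivity.
Qed.

(** Needed to see that [upper] moves points strictly to the left; the right end is left out because
    [upper] fixes it. *)
Lemma gen_angle_lt_shift (x : R) : - b <= x < b - d -> F x < x + 2 * d.
Proof.
  intros Hx. pose proof beta_bounds. pose proof step_bounds. pose proof PI_RGT_0.
  pose proof cosb_bounds.
  apply gen_angle_lt; try lra.
  replace ((x + 2 * d - x) / 2) with d by field.
  replace ((x + 2 * d + x) / 2) with (x + d) by field.
  rewrite <- cosb_sqr. apply Rmult_lt_compat_l; [lra |].
  rewrite <- cos_beta.
  destruct (Rle_lt_dec 0 (x + d)).
  - apply cos_decreasing_1; lra.
  - rewrite <- (cos_neg (x + d)). apply cos_decreasing_1; lra.
Qed.

(* Angles of a point measured from the centre of side [j]; the arc (P_j, Q_j)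
   is the interval (- beta, beta - step). *)
Definition side_pt (j : Z) (x : R) : C := cis (alpha g j + x).

Lemma alpha_add (j k : Z) : alpha g (j + k) = alpha g j + d * IZR k.
Proof.
  pose proof (IZR_le _ _ Nsides_ge).
  unfold alpha, step. rewrite plus_IZR. field. lra.
Qed.

Lemma side_pt_shift (j k : Z) (x : R) : side_pt (j + k) x = side_pt j (x + d * IZR k).
Proof. unfold side_pt. rewrite alpha_add. f_equal. ring. Qed.

Lemma side_pt_period (j m : Z) (x : R) : side_pt (j + m * N) x = side_pt j x.
Proof.
  rewrite side_pt_shift, mult_IZR.
  replace (d * (IZR m * IZR N)) with (2 * PI * IZR m) by (rewrite <- step_mul_N; ring).
  unfold side_pt. rewrite <- Rplus_assoc. apply cis_add_2PI_mult.
Qed.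

(* [T_i] in rotated coordinates is [w |-> s] with [w s - (w + s) / c + 1 = 0]. *)
Lemma gen_angle_bilinear (x : R) : - PI < x < PI ->
  (cis x * cis (F x) + 1 = RtoC (/ c) * (cis x + cis (F x)))%C.
Proof.
  intros Hx. pose proof cosb_bounds as Hc. pose proof (gen_angle_cos x Hx) as H.
  set (m := (F x + x) / 2) in *. set (h := (F x - x) / 2) in *.
  replace (cis x) with (cis (m - h)) by (f_equal; unfold m, h; field).
  replace (cis (F x)) with (cis (m + h)) by (f_equal; unfold m, h; field).
  rewrite <- cis_add. replace (m - h + (m + h)) with (2 * m) by ring.
  unfold cis, Cplus, Cmult, RtoC; simpl.
  rewrite cos_minus, cos_plus, sin_minus, sin_plus, cos_2a_cos, sin_2a, H.
  f_equal; field; lra.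
Qed.

Lemma inv_cosb_gt_1 : 1 < / c.
Proof. pose proof cosb_bounds. rewrite <- Rinv_1. apply Rinv_lt_contravar; lra. Qed.

Lemma Cconj_cis (t : R) : Cconj (cis t) = cis (- t).
Proof. unfold Cconj, cis; simpl. now rewrite cos_neg, sin_neg. Qed.

Lemma Tgen_side_pt (j : Z) (x : R) : - PI < x < PI ->
  Tgen g j (side_pt j x) = side_pt (sigma g j) (F x).
Proof.
  intros Hx. pose proof cosb_bounds as Hc.
  pose proof (cis_sub_RtoC_neq_0 x _ inv_cosb_gt_1) as Hd.
  pose proof (gen_angle_bilinear x Hx) as HB.
  pose proof (cis_neq_0 (alpha g j)) as Ha.
  unfold Tgen, side_pt, ctr, rad2.
  rewrite Cmult_conj, Cconj_cis.
  replace (Cconj (RtoC (/ c))) with (RtoC (/ c))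
    by (unfold Cconj, RtoC; simpl; f_equal; ring).
  rewrite !cis_add.
  replace (cis (- alpha g j)) with (/ cis (alpha g j))%C.
  2:{ apply Cmult_cancel_l with (cis (alpha g j)); [assumption |].
      rewrite <- cis_add, Rplus_opp_r. rewrite Cinv_r by assumption.
      unfold cis. now rewrite cos_0, sin_0. }
  replace (RtoC (/ (c * c) - 1)) with (RtoC (/ c) * RtoC (/ c) - 1)%C.
  2:{ rewrite <- RtoC_mult, <- RtoC_minus. f_equal. field. lra. }
  (* Only algebra remains: w and s are source and image, e and f the rotations to the two sides,
     [C0] the distance of the centres from 0. The bilinear relation solved for s is the inversion
     formula. *)
  revert HB Hd Ha. generalize (cis x) (cis (F x)) (RtoC (/ c)) (cis (alpha g j))
    (cis (alpha g (sigma g j))).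
  clear. intros w s C0 e f HB Hd He.
  assert (Hs : s = (C0 + (C0 * C0 - 1) / (w - C0))%C).
  { apply Cmult_cancel_l with (w - C0)%C; [assumption |].
    transitivity ((w * s + 1) - C0 * s - 1)%C; [ring |].
    rewrite HB. field. assumption. }
  rewrite Hs. field. repeat split; try assumption.
  replace (e * w - C0 * e)%C with (e * (w - C0))%C by ring.
  now apply Cmult_neq_0.
Qed.

Lemma sigma_odd (j : Z) : Z.odd j = true -> sigma g j = (4 * Z.of_nat g - j)%Z.
Proof. intros H. unfold sigma. now rewrite H. Qed.

Lemma sigma_even (j : Z) : Z.odd j = false -> sigma g j = (2 - j)%Z.
Proof. intros H. unfold sigma. now rewrite H. Qed.

Lemma odd_add_mul_N (j m : Z) : Z.odd (j + m * N) = Z.odd j.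
Proof.
  replace (j + m * N)%Z with (j + 2 * (m * (4 * Z.of_nat g - 2)))%Z
    by (unfold Nsides; ring).
  apply Z.odd_add_mul_2.
Qed.

Lemma Tgen_period (j m : Z) : Tgen g (j + m * N) = Tgen g j.
Proof.
  assert (H1 : cis (alpha g (j + m * N)) = cis (alpha g j)).
  { pose proof (side_pt_period j m 0) as H. unfold side_pt in H. now rewrite !Rplus_0_r in H. }
  assert (H2 : cis (alpha g (sigma g (j + m * N))) = cis (alpha g (sigma g j))).
  { pose proof (side_pt_period (sigma g j) (- m) 0) as H. unfold side_pt in H.
    rewrite !Rplus_0_r in H. rewrite <- H. f_equal. f_equal.
    unfold sigma. rewrite odd_add_mul_N. destruct (Z.odd j); ring. }
  unfold Tgen, ctr. rewrite !cis_add, H1, H2. reflexivity.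
Qed.

(** * The overshooting moves and the vertex relation *)

(** For z at angle x of side j, this is the angle of T_j z from side sigma(j)+2. [lower] is that of
    T_{j-1} z from side sigma(j-1)-1: there x + d is the angle of z from side j-1, and 2 PI selects
    the branch. *)
Definition upper (x : R) : R := F x - 2 * d.
Definition lower (x : R) : R := F (x + d) + d - 2 * PI.

Lemma upper_increasing (x y : R) : - b <= x -> x < y -> y <= b - d -> upper x < upper y.
Proof.
  intros. pose proof beta_bounds. pose proof step_bounds. pose proof PI_RGT_0.
  assert (F x < F y) by (apply gen_angle_increasing; lra). unfold upper. lra.
Qed.

Lemma lower_reflect (x : R) : lower x = - d - upper (- d - x).
Proof.
  unfold lower, upper. replace (- d - x) with (- (x + d)) by ring.
  rewrite gen_angle_opp. ring.
Qed.

(** The ends of I go to b - 2d < -b and b - d, so an upper move can leave I only on the left. *)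
Lemma upper_range (x : R) : - b < x < b - d -> b - 2 * d < upper x < b - d.
Proof.
  intros Hx. pose proof beta_bounds. pose proof step_bounds. pose proof PI_RGT_0.
  assert (upper (- b) < upper x) by (apply upper_increasing; lra).
  assert (upper x < upper (b - d)) by (apply upper_increasing; lra).
  unfold upper in *. rewrite gen_angle_P, gen_angle_Q in *. lra.
Qed.

Lemma lower_range (x : R) : - b < x < b - d -> - b < lower x < d - b.
Proof.
  intros Hx. rewrite lower_reflect.
  assert (b - 2 * d < upper (- d - x) < b - d) by (apply upper_range; lra). lra.
Qed.

Lemma Tgen_upper (j : Z) (x : R) : - b < x < b - d ->
  Tgen g j (side_pt j x) = side_pt (sigma g j + 2) (upper x).
Proof.
  intros Hx. pose proof beta_bounds. pose proof step_bounds. pose proof PI_RGT_0.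
  rewrite Tgen_side_pt by lra. rewrite side_pt_shift. f_equal. unfold upper. ring.
Qed.

Lemma Tgen_lower (j : Z) (x : R) : - b < x < b - d ->
  Tgen g (j - 1) (side_pt j x) = side_pt (sigma g (j - 1) - 1) (lower x).
Proof.
  intros Hx. pose proof beta_bounds. pose proof step_bounds. pose proof PI_RGT_0.
  replace (side_pt j x) with (side_pt (j - 1 + 1) x) by (f_equal; ring).
  rewrite side_pt_shift, Rmult_1_r, Tgen_side_pt by lra.
  change (sigma g (j - 1) - 1)%Z with (sigma g (j - 1) + -1)%Z. rewrite side_pt_shift. unfold side_pt, lower.
  rewrite <- (cis_add_2PI_mult _ (-1)). f_equal. ring.
Qed.

(** The vertex relation as algebra, with q = [cis d] and k = 1/c. One side composes w -> q t and t
    -> p, the other q w -> s and q s -> r; [Hk] encodes c^2 = cos d. *)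
Lemma step_relation (k q w t p s r : C) :
  (k * k * (q * q + 1) = 2 * q)%C ->
  (q * w - k <> 0)%C -> (q * s - k <> 0)%C ->
  (w * (q * t) + 1 = k * (w + q * t))%C -> (t * p + 1 = k * (t + p))%C ->
  (q * w * s + 1 = k * (q * w + s))%C -> (q * s * r + 1 = k * (q * s + r))%C ->
  p = (q * r)%C.
Proof.
  intros Hk Hw Hs H1 H2 H3 H4.
  apply Cmult_cancel_l with ((q * w - k) * (q * s - k))%C; [now apply Cmult_neq_0 |].
  assert (E1 : (q * t * (w - k) = k * w - 1)%C).
  { transitivity (w * (q * t) + 1 - k * (q * t) - 1)%C; [ring | rewrite H1; ring]. }
  assert (E2 : (p * (t - k) = k * t - 1)%C).
  { transitivity (t * p + 1 - k * p - 1)%C; [ring | rewrite H2; ring]. }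
  assert (E3 : (s * (q * w - k) = k * (q * w) - 1)%C).
  { transitivity (q * w * s + 1 - k * s - 1)%C; [ring | rewrite H3; ring]. }
  assert (E4 : (r * (q * s - k) = k * (q * s) - 1)%C).
  { transitivity (q * s * r + 1 - k * r - 1)%C; [ring | rewrite H4; ring]. }
  (* The denominators of the two composites are proportional. *)
  assert (D : ((q * w - k) * (q * s - k) = - q * (q * (w - k) * (t - k)))%C).
  { transitivity (q * (s * (q * w - k)) - k * (q * w - k))%C; [ring |].
    transitivity (- q * (q * t * (w - k) - k * q * (w - k)))%C; [| ring].
    rewrite E1, E3.
    transitivity (- q * (k * w - 1 - k * q * (w - k)) + (k * k * (q * q + 1) - 2 * q))%C;
      [ring | rewrite Hk; ring]. }
  transitivity (- q * (q * (w - k)) * (p * (t - k)))%C; [rewrite D; ring |].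
  transitivity (q * (q * w - k) * (r * (q * s - k)))%C; [| ring].
  rewrite E2, E4.
  transitivity (- q * (k * (q * t * (w - k)) - q * (w - k)))%C; [ring |].
  transitivity (q * (k * q * (s * (q * w - k)) - (q * w - k)))%C; [| ring].
  rewrite E1, E3.
  transitivity (q * (k * q * (k * (q * w) - 1) - (q * w - k))
    - q * w * (k * k * (q * q + 1) - 2 * q))%C; [ring | rewrite Hk; ring].
Qed.

Lemma upper_lower_cis (x : R) : - b < x < b - d ->
  cis (F (upper x + d)) = cis (F (lower x) + d).
Proof.
  intros Hx. pose proof beta_bounds. pose proof step_bounds. pose proof PI_RGT_0.
  pose proof (upper_range x Hx). pose proof (lower_range x Hx).
  pose proof cosb_bounds as Hc.
  rewrite (Rplus_comm (F (lower x)) d), cis_add.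
  assert (E1 : (cis d * cis (upper x + d) = cis (F x))%C).
  { rewrite <- cis_add. f_equal. unfold upper. ring. }
  assert (E2 : (cis d * cis x = cis (x + d))%C).
  { rewrite <- cis_add. f_equal. ring. }
  assert (E3 : (cis d * cis (F (x + d)) = cis (lower x))%C).
  { rewrite <- cis_add, <- (cis_add_2PI_mult (lower x) 1). f_equal. unfold lower. ring. }
  apply step_relation with (k := RtoC (/ c)) (w := cis x) (t := cis (upper x + d))
    (s := cis (F (x + d))); rewrite ?E1, ?E2, ?E3;
    try (apply cis_sub_RtoC_neq_0, inv_cosb_gt_1);
    try (apply gen_angle_bilinear; lra).
  rewrite <- RtoC_mult.
  replace (/ c * / c) with (/ cos d) by (rewrite <- cosb_sqr; field; lra).
  pose proof cos_step_bounds. pose proof (sin2_cos2 d) as Hsc. unfold Rsqr in Hsc.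
  unfold cis, Cplus, Cmult, RtoC; simpl.
  f_equal; [| field; lra].
  replace (cos d * cos d - sin d * sin d + 1) with (2 * cos d * cos d) by lra.
  field. lra.
Qed.

(** If both moves stayed in I, the vertex relation would identify an angle in (2 PI - b - d, 2 PI)
    with one in (b + d, b + 2d), and these arcs are disjoint. *)
Lemma upper_lower_exclusive (x : R) : - b < x < b - d ->
  - b < upper x -> lower x < b - d -> False.
Proof.
  intros Hx Hu Hl. pose proof beta_bounds. pose proof step_bounds. pose proof PI_RGT_0.
  pose proof (upper_range x Hx). pose proof (lower_range x Hx).
  pose proof (upper_lower_cis x Hx) as E.
  pose proof (gen_angle_range (upper x + d)).
  assert (F (- (b - d)) < F (upper x + d)) by (apply gen_angle_increasing; lra).
  rewrite gen_angle_opp, gen_angle_Q in *.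
  assert (F (- b) < F (lower x)) by (apply gen_angle_increasing; lra).
  assert (F (lower x) < F (b - d)) by (apply gen_angle_increasing; lra).
  rewrite gen_angle_P, gen_angle_Q in *.
  apply cis_inj in E; lra.
Qed.

(** Since [upper] is increasing, x <= y would let both moves from y stay in I. *)
Lemma upper_lower_separated (x y : R) : - b < x < b - d -> - b < y < b - d ->
  - b < upper x -> lower y < b - d -> y < x.
Proof.
  intros Hx Hy Hu Hl. apply Rnot_le_lt. intros Hle.
  apply (upper_lower_exclusive y); try assumption.
  destruct Hle as [Hlt | ->]; [| assumption].
  pose proof (upper_increasing x y). lra.
Qed.

(* The vertex relation T_{rho^3(j)} T_{rho^2(j)} T_{rho(j)} T_j = Id, cut in half. *)
Lemma Tgen_cycle (j : Z) (x : R) : - b < x < b - d ->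
  Tgen g (sigma g j + 1) (Tgen g j (side_pt j x)) =
  Tgen g (sigma g (j - 1) - 1) (Tgen g (j - 1) (side_pt j x)).
Proof.
  intros Hx. pose proof beta_bounds. pose proof step_bounds. pose proof PI_RGT_0.
  pose proof (upper_range x Hx). pose proof (lower_range x Hx).
  rewrite Tgen_lower, Tgen_upper by assumption.
  replace (sigma g j + 2)%Z with (sigma g j + 1 + 1)%Z by ring.
  rewrite side_pt_shift, Rmult_1_r, !Tgen_side_pt by lra.
  (* Modulo N the two routes end at neighbouring sides, which accounts for the extra d in
     [upper_lower_cis]. *)
  assert (Hs : exists m, sigma g (sigma g (j - 1) - 1)%Z =
                         (sigma g (sigma g j + 1) + 1 + m * N)%Z).
  { destruct (Z.odd j) eqn:Ho.
    - rewrite (sigma_odd j), (sigma_even (j - 1)) by (rewrite ?Z.odd_sub, ?Ho; reflexivity).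
      rewrite sigma_odd, sigma_even
        by (rewrite ?Z.odd_add, ?Z.odd_sub, ?Z.odd_mul, ?Ho; reflexivity).
      exists 1%Z. unfold Nsides. ring.
    - rewrite (sigma_even j), (sigma_odd (j - 1)) by (rewrite ?Z.odd_sub, ?Ho; reflexivity).
      rewrite sigma_even, sigma_odd
        by (rewrite ?Z.odd_add, ?Z.odd_sub, ?Z.odd_mul, ?Ho; reflexivity).
      exists (-1)%Z. unfold Nsides. ring. }
  destruct Hs as [m ->]. rewrite side_pt_period, side_pt_shift, Rmult_1_r.
  unfold side_pt. rewrite !cis_add. f_equal. rewrite <- cis_add.
  now apply upper_lower_cis.
Qed.

(** * Runs of a single move *)

Lemma upper_continuous (x : R) : - PI < x < PI -> continuity_pt upper x.
Proof.
  intros Hx.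
  apply continuity_pt_filterlim, (ex_derive_continuous upper).
  unfold upper, gen_angle, tan. auto_derive.
  apply Rgt_not_eq, cos_gt_0; lra.
Qed.

(** Such a run decreases to a fixed point of [upper] in [-b, b - d), where there is none. *)
Lemma upper_run_finite (x : nat -> R) :
  (forall n, - b < x n < b - d) -> (forall n, x (S n) = upper (x n)) -> False.
Proof.
  intros Hx Hs. pose proof beta_bounds. pose proof step_bounds. pose proof PI_RGT_0.
  assert (Hlt : forall y, - b <= y < b - d -> upper y < y).
  { intros y Hy. pose proof (gen_angle_lt_shift y Hy). unfold upper. lra. }
  assert (Hdec : Un_decreasing x).
  { intros n. rewrite Hs. apply Rlt_le, Hlt. specialize (Hx n). lra. }
  destruct (decreasing_cv x Hdec) as [l Hl].
  { exists b. intros y [n ->]. unfold opp_seq. specialize (Hx n). lra. }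
  assert (Hl1 : l <= x 0%nat) by (apply (decreasing_ineq x l Hdec Hl)).
  assert (Hl2 : - b <= l).
  { apply Rnot_lt_le. intros Hlb. destruct (Hl (- b - l)) as [n Hn]; [lra |].
    specialize (Hn n (le_n n)). specialize (Hx n). unfold Rdist in Hn.
    rewrite Rabs_right in Hn; lra. }
  pose proof (Hx 0%nat).
  assert (Hu : upper l = l).
  { apply (UL_sequence (fun n => x (S n))).
    - apply Un_cv_ext with (fun n => upper (x n)); [intros; now rewrite Hs |].
      apply continuity_seq; [apply upper_continuous; lra | assumption].
    - intros e He. destruct (Hl e He) as [n Hn]. exists n. intros m Hm. apply Hn. lia. }
  specialize (Hlt l). lra.
Qed.

Lemma lower_run_finite (x : nat -> R) :
  (forall n, - b < x n < b - d) -> (forall n, x (S n) = lower (x n)) -> False.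
Proof.
  intros Hx Hs. apply (upper_run_finite (fun n => - d - x n)).
  - intros n. specialize (Hx n). lra.
  - intros n. rewrite Hs, lower_reflect. ring.
Qed.

(** * The boundary map in angular coordinates *)

Lemma side_pt_mul_cis (j : Z) (x t : R) : Cmult (side_pt j x) (cis t) = side_pt j (x + t).
Proof. unfold side_pt. rewrite <- cis_add. f_equal. ring. Qed.

Lemma Ppt_eq (j : Z) : Ppt g j = side_pt j (- b).
Proof.
  unfold Ppt, side_pt. rewrite cis_add. f_equal. unfold cis.
  now rewrite cos_neg, sin_neg, cos_beta, sin_beta.
Qed.

Lemma Qpt_eq (j : Z) : Qpt g j = side_pt j (b - d).
Proof.
  unfold Qpt. replace (cosb g, sinb g) with (cis b)
    by (unfold cis; now rewrite cos_beta, sin_beta).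
  rewrite <- cis_add. change (side_pt (j - 1) b = side_pt j (b - d)).
  change (j - 1)%Z with (j + -1)%Z. rewrite side_pt_shift. f_equal. ring.
Qed.

Lemma arc_PQ (j : Z) (z : C) : arc_oo (Ppt g j) (Qpt g j) z ->
  exists x, - b < x < b - d /\ z = side_pt j x.
Proof.
  pose proof beta_bounds. pose proof step_bounds. pose proof PI_RGT_0.
  intros (tb & tx & Htb & Htx & HQ & Hz).
  rewrite Ppt_eq, Qpt_eq, side_pt_mul_cis in HQ. rewrite Ppt_eq, side_pt_mul_cis in Hz.
  assert (alpha g j + (b - d) = alpha g j + (- b + tb)) by (apply cis_inj; [lra | exact HQ]).
  exists (- b + tx). split; [lra | assumption].
Qed.

Section Partition.

Variables (A : Z -> C) (a : Z -> R).
Hypothesis a_range : forall j, - b < a j < b - d.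
Hypothesis A_eq : forall j, A j = side_pt j (a j).
Hypothesis a_period : forall j m, a (j + m * N)%Z = a j.

Lemma partition_succ (j : Z) : A (j + 1)%Z = side_pt j (a (j + 1)%Z + d).
Proof. rewrite A_eq, side_pt_shift. f_equal. ring. Qed.

(** Holds because I has length 2b - d, less than the spacing d of the sides. *)
Lemma partition_increasing (j k : Z) : (j < k)%Z ->
  d * IZR j + a j < d * IZR k + a k.
Proof.
  intros Hjk. pose proof beta_bounds. pose proof step_bounds.
  assert (IZR j + 1 <= IZR k) by (rewrite <- plus_IZR; apply IZR_le; lia).
  pose proof (a_range j). pose proof (a_range k). nra.
Qed.

Lemma arc_length_eq (j : Z) (t : R) : 0 < t < 2 * PI ->
  A (j + 1)%Z = Cmult (A j) (cis t) -> a j + t = a (j + 1)%Z + d.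
Proof.
  intros Ht H. pose proof beta_bounds. pose proof step_bounds. pose proof PI_RGT_0.
  pose proof (a_range j). pose proof (a_range (j + 1)).
  rewrite partition_succ, A_eq, side_pt_mul_cis in H.
  symmetry in H. apply cis_inj in H; lra.
Qed.

(** Lifted to the line, the arcs between consecutive partition points tile it. The disjunction
    serves both half-open conventions, for [fA] and for [fA_minus]. *)
Lemma arc_index (j k : Z) (x y : R) :
  side_pt j x = side_pt k y ->
  a j <= x <= a (j + 1)%Z + d -> a k <= y <= a (k + 1)%Z + d ->
  (x < a (j + 1)%Z + d /\ y < a (k + 1)%Z + d) \/ (a j < x /\ a k < y) ->
  exists m, k = (j + m * N)%Z.
Proof.
  intros E Hx Hy Hs. apply cis_eq in E as [m Hm].
  set (l := (k + m * N)%Z).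
  assert (El : d * IZR j + x = d * IZR l + y).
  { unfold l. rewrite plus_IZR, mult_IZR.
    pose proof (alpha_add 0 j) as E1. pose proof (alpha_add 0 k) as E2.
    rewrite Z.add_0_l in E1, E2. pose proof step_mul_N. nra. }
  assert (Hl0 : a l = a k) by apply a_period.
  assert (Hl1 : a (l + 1)%Z = a (k + 1)%Z).
  { replace (l + 1)%Z with (k + 1 + m * N)%Z by (unfold l; ring). apply a_period. }
  rewrite <- Hl0, <- Hl1 in *.
  exists (- m)%Z. enough (l = j) by (unfold l in *; lia).
  assert (Hmono : forall p q, (p < q)%Z -> d * IZR (p + 1) + a (p + 1)%Z <= d * IZR q + a q).
  { intros p q Hpq. destruct (Z.eq_dec (p + 1) q) as [-> | Hne]; [lra |].
    apply Rlt_le, partition_increasing. lia. }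
  destruct (Z.lt_trichotomy l j) as [Hlt | [Heq | Hlt]]; [| assumption |];
    apply Hmono in Hlt; rewrite plus_IZR in Hlt; exfalso; lra.
Qed.

(** The choice in [fA] is determined: the index is unique modulo N and [Tgen] is N-periodic in
    it. *)
Lemma fA_side_pt (j : Z) (x : R) : a j <= x < a (j + 1)%Z + d ->
  fA g A (side_pt j x) = Tgen g j (side_pt j x).
Proof.
  intros Hx. pose proof beta_bounds. pose proof step_bounds. pose proof PI_RGT_0.
  pose proof (a_range j). pose proof (a_range (j + 1)).
  unfold fA. apply epsilon_unique.
  { exists j. split; [| reflexivity].
    exists (a (j + 1)%Z + d - a j), (x - a j). repeat split; try lra.
    - rewrite partition_succ, A_eq, side_pt_mul_cis. f_equal. ring.
    - rewrite A_eq, side_pt_mul_cis. f_equal. ring. }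
  intros y (k & (tb & tx & Htb & Htx & HA & Hp) & ->).
  apply arc_length_eq in HA; [| assumption].
  rewrite A_eq, side_pt_mul_cis in Hp.
  destruct (arc_index j k x (a k + tx) Hp) as [m ->]; try lra.
  now rewrite Tgen_period.
Qed.

Lemma fA_minus_side_pt (j : Z) (x : R) : a j < x <= a (j + 1)%Z + d ->
  fA_minus g A (side_pt j x) = Tgen g j (side_pt j x).
Proof.
  intros Hx. pose proof beta_bounds. pose proof step_bounds. pose proof PI_RGT_0.
  pose proof (a_range j). pose proof (a_range (j + 1)).
  unfold fA_minus. apply epsilon_unique.
  { exists j. split; [| reflexivity].
    exists (a (j + 1)%Z + d - a j), (x - a j). repeat split; try lra.
    - rewrite partition_succ, A_eq, side_pt_mul_cis. f_equal. ring.
    - rewrite A_eq, side_pt_mul_cis. f_equal. ring. }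
  intros y (k & (tb & tx & Htb & Htx & HA & Hp) & ->).
  apply arc_length_eq in HA; [| assumption].
  rewrite A_eq, side_pt_mul_cis in Hp.
  destruct (arc_index j k x (a k + tx) Hp) as [m ->]; try lra.
  now rewrite Tgen_period.
Qed.

(** * Non-existence of infinite runs *)

(* A pair of orbits that has not met yet is in state (j, x): up to the common
   time shift, they sit at T_j z and T_{j-1} z with z at angle x of side j.
   [w n] tells whether it is the upper orbit that overshoots at time n. *)
Section Run.

Variables (J : nat -> Z) (x : nat -> R) (w : nat -> bool).
Hypothesis x_range : forall n, - b < x n < b - d.
Hypothesis upper_step : forall n, w n = true ->
  J (S n) = (sigma g (J n) + 2)%Z /\ x (S n) = upper (x n) /\ a (J (S n)) <= x (S n).
Hypothesis lower_step : forall n, w n = false ->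
  J (S n) = (sigma g (J n - 1) - 1)%Z /\ x (S n) = lower (x n) /\ x (S n) <= a (J (S n)).

(** The constants c_U (v true) and c_L (v false) of the index involutions, for indices odd exactly
    when o is true. *)
Definition flip (o : bool) (v : bool) : Z :=
  if v then (if o then 4 * Z.of_nat g + 2 else 4)%Z
  else (if o then 2 else 4 * Z.of_nat g)%Z.

Local Notation c_ := (flip (Z.odd (J 0))).

Lemma flip_odd (o v : bool) : Z.odd (flip o v) = false.
Proof.
  destruct o, v; unfold flip; rewrite ?Z.odd_add, ?Z.odd_mul; reflexivity.
Qed.

(** Both constants are even, so the parity of the index persists and the same two involutions act
    throughout. *)
Lemma run_succ (n : nat) : J (S n) = (c_ (w n) - J n)%Z /\ Z.odd (J n) = Z.odd (J 0).
Proof.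
  induction n as [| n [IH Ho]].
  - split; [| reflexivity]. destruct (w 0%nat) eqn:Hw; unfold flip.
    + destruct (upper_step _ Hw) as [-> _]. unfold sigma. destruct (Z.odd (J 0)); ring.
    + destruct (lower_step _ Hw) as [-> _]. unfold sigma. rewrite Z.odd_sub.
      change (Z.odd 1) with true. destruct (Z.odd (J 0)); cbn [xorb]; ring.
  - assert (Ho' : Z.odd (J (S n)) = Z.odd (J 0))
      by (rewrite IH, Z.odd_sub, flip_odd, Ho; now destruct (Z.odd (J 0))).
    split; [| assumption].
    destruct (w (S n)) eqn:Hw; unfold flip.
    + destruct (upper_step _ Hw) as [-> _]. unfold sigma. rewrite Ho'.
      destruct (Z.odd (J 0)); ring.
    + destruct (lower_step _ Hw) as [-> _]. unfold sigma. rewrite Z.odd_sub, Ho'.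
      change (Z.odd 1) with true. destruct (Z.odd (J 0)); cbn [xorb]; ring.
Qed.

Lemma run_switch (v : bool) (n : nat) : exists m, w (n + m)%nat = negb v.
Proof.
  destruct (classic (exists m, w (n + m)%nat = negb v)) as [H | H]; [assumption | exfalso].
  assert (Hw : forall m, w (n + m)%nat = v).
  { intros m. destruct (Bool.bool_dec (w (n + m)%nat) (negb v)) as [E | E].
    - exfalso. apply H. now exists m.
    - now destruct v, (w (n + m)%nat). }
  destruct v.
  - apply (upper_run_finite (fun m => x (n + m)%nat)); intros m; [apply x_range |].
    rewrite Nat.add_succ_r. now apply upper_step.
  - apply (lower_run_finite (fun m => x (n + m)%nat)); intros m; [apply x_range |].
    rewrite Nat.add_succ_r. now apply lower_step.
Qed.

Definition passes (v : bool) (i : Z) : Prop :=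
  exists n m, w n = v /\ w (S n) = negb v /\ J (S n) = (i + m * N)%Z.

(* An upper arrival followed by a lower step lies left of every lower arrival
   followed by an upper step, but A_i separates them the other way round. *)
Lemma passes_exclusive (i : Z) : passes true i -> passes false i -> False.
Proof.
  intros (n & m & Hn & Hn' & Hi) (p & q & Hp & Hp' & Hi'). simpl in *.
  destruct (upper_step n Hn) as (_ & _ & H1).
  destruct (lower_step p Hp) as (_ & _ & H2).
  rewrite Hi, a_period in H1. rewrite Hi', a_period in H2.
  destruct (lower_step _ Hn') as (_ & H3 & _). destruct (upper_step _ Hp') as (_ & H4 & _).
  (* The next positions lie in I, so [upper_lower_separated] applies to the two departures. *)
  pose proof (x_range (S (S n))). pose proof (x_range (S (S p))).
  assert (x (S n) < x (S p)); [| lra].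
  apply upper_lower_separated; try apply x_range; lra.
Qed.

Lemma passes_opposite (v : bool) (i : Z) : passes v i -> passes (negb v) i -> False.
Proof. destruct v; simpl; intros; eapply passes_exclusive; eassumption. Qed.

(* After passing i the run bounces on one edge of the graph of the involutions
   j |-> c - j until it passes the other end of that edge. *)
Lemma passes_next (v : bool) (i : Z) : passes v i -> passes (negb v) (c_ (negb v) - i).
Proof.
  intros Hi. pose proof Hi as (n & m & Hn & Hn' & HJ).
  assert (Hp : forall p, passes (negb v) (c_ (negb v) - i) \/
    (w (S n + p)%nat = negb v /\
     exists m, J (S n + p)%nat = (i + m * N)%Z \/
               J (S n + p)%nat = (c_ (negb v) - i + m * N)%Z)).
  { induction p as [| p [IH | [IHw [m' IHJ]]]]; [| now left |].
    - right. rewrite Nat.add_0_r. split; [assumption |]. exists m. now left.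
    - rewrite Nat.add_succ_r. destruct (run_succ (S n + p)) as [HS _].
      rewrite IHw in HS.
      assert (HS' : J (S (S n + p)) = (i + - m' * N)%Z \/
                    J (S (S n + p)) = (c_ (negb v) - i + - m' * N)%Z) by lia.
      destruct (Bool.bool_dec (w (S (S n + p))) (negb v)) as [E | E].
      + right. split; [assumption |]. now exists (- m')%Z.
      + assert (E' : w (S (S n + p)) = negb (negb v))
          by (destruct v, (w (S (S n + p))); simpl in *; congruence).
        destruct HS' as [HS' | HS'].
        (* Turning at i itself would cross i in the opposite direction. *)
        * exfalso. apply (passes_opposite v i Hi). now exists (S n + p)%nat, (- m')%Z.
        * left. now exists (S n + p)%nat, (- m')%Z. }
  destruct (run_switch (negb v) (S n)) as [p Hw].
  destruct (Hp p) as [H | [H _]]; [assumption |]. rewrite H in Hw. now destruct v.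
Qed.

(** Two uses of [passes_next] compose the two involutions into a translation. *)
Lemma passes_iter (i : Z) (k : nat) : passes true i ->
  passes true (i + Z.of_nat k * (c_ true - c_ false)).
Proof.
  intros Hi. induction k as [| k IH].
  - now replace (i + Z.of_nat 0 * _)%Z with i by ring.
  - apply passes_next, passes_next in IH. simpl negb in IH.
    rewrite Nat2Z.inj_succ.
    replace (i + Z.succ (Z.of_nat k) * (c_ true - c_ false))%Z
      with (c_ true - (c_ false - (i + Z.of_nat k * (c_ true - c_ false))))%Z by ring.
    assumption.
Qed.

Lemma passes_mod (v : bool) (i m : Z) : passes v (i + m * N) -> passes v i.
Proof.
  intros (n & p & Hn & Hn' & HJ). exists n, (m + p)%Z. repeat split; try assumption.
  rewrite HJ. ring.
Qed.

(* [c true - c false] is 4 times a unit modulo N / 4 = 2 g - 1, with inverse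
   [2] up to sign, so its multiples reach the mirror image of [i]. *)
Lemma mirror_reachable (i : Z) : Z.odd i = Z.odd (J 0) ->
  exists k m, (i + Z.of_nat k * (c_ true - c_ false) = c_ false - i + m * N)%Z.
Proof.
  intros <-. unfold flip, Nsides. set (G := Z.of_nat g).
  assert (HG : (2 <= G)%Z) by (unfold G; lia).
  destruct (Z.odd i) eqn:Ho.
  - apply Z.odd_spec in Ho as [h ->].
    (* Divided by 4 the equation reads h + G k = m (2G - 1). As 2G = 1 modulo 2G - 1, k = -2h solves
       it; the added multiple of 2G - 1 makes k nonnegative. *)
    exists (Z.to_nat (- 2 * h + (2 * G - 1) * (2 * Z.abs h))).
    exists (- h + G * (2 * Z.abs h))%Z.
    rewrite Z2Nat.id by nia. ring.
  - assert (He : Z.even i = true) by (rewrite <- Z.negb_odd, Ho; reflexivity).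
    apply Z.even_spec in He as [h ->].
    (* Here it reads h - G + k (1 - G) = m (2G - 1), and 2 (1 - G) = 1 modulo 2G - 1. *)
    exists (Z.to_nat (2 * (G - h) + (2 * G - 1) * (2 * Z.abs h))).
    exists (- (G - h) - (G - 1) * (2 * Z.abs h))%Z.
    rewrite Z2Nat.id by nia. ring.
Qed.

(** An upper-to-lower crossing at i forces a lower-to-upper one at c_L - i. Translates of the first
    crossing reach that same index, against [passes_exclusive]. *)
Lemma no_infinite_run : False.
Proof.
  destruct (run_switch false 0) as [n Hn]. simpl in Hn.
  assert (Hp : exists p, w p = true /\ w (S p) = false).
  { destruct (run_switch true n) as [m Hm]. simpl in Hm.
    induction m as [| m IH]; [rewrite Nat.add_0_r in Hm; congruence |].
    rewrite Nat.add_succ_r in Hm.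
    destruct (w (n + m)%nat) eqn:E; [now exists (n + m)%nat | now apply IH]. }
  destruct Hp as (p & Hp & Hp').
  assert (Hpass : passes true (J (S p))).
  { exists p, 0%Z. repeat split; try assumption. ring. }
  destruct (mirror_reachable (J (S p))) as (k & m & Hk); [apply run_succ |].
  apply (passes_exclusive (c_ false - J (S p))).
  - apply passes_mod with m. rewrite <- Hk. now apply passes_iter.
  - now apply passes_next in Hpass.
Qed.

End Run.

(** * From orbits to runs *)

Definition goes_upper (s : Z * R) : bool :=
  if Rle_dec (a (sigma g (fst s) + 2)%Z) (upper (snd s)) then true else false.

Definition next_state (s : Z * R) : Z * R :=
  if goes_upper s then (sigma g (fst s) + 2, upper (snd s))%Z
  else (sigma g (fst s - 1) - 1, lower (snd s))%Z.

Definition tracks (s : Z * R) (X Y : C) : Prop :=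
  - b < snd s < b - d /\
  X = Tgen g (fst s) (side_pt (fst s) (snd s)) /\
  Y = Tgen g (fst s - 1) (side_pt (fst s) (snd s)).

(** If neither orbit overshoots, the vertex relation makes the images equal; both cannot, by
    [upper_lower_exclusive]. If exactly one does, the vertex relation rewrites the other image so
    that both start from one point of the new side. The lower bound is a conclusion because
    [goes_upper] tests only the upper orbit. *)
Lemma tracks_next (s : Z * R) (X Y : C) :
  tracks s X Y -> fA g A X <> fA_minus g A Y ->
  tracks (next_state s) (fA g A X) (fA_minus g A Y) /\
  (goes_upper s = false -> lower (snd s) <= a (sigma g (fst s - 1) - 1)%Z).
Proof.
  destruct s as [j x]. unfold tracks, next_state, goes_upper. cbn [fst snd].
  intros (Hx & HX & HY) Hne.
  pose proof beta_bounds. pose proof step_bounds. pose proof PI_RGT_0.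
  pose proof (upper_range x Hx). pose proof (lower_range x Hx).
  pose proof (upper_lower_exclusive x Hx) as Hexcl.
  pose proof (Tgen_cycle j x Hx) as Hcyc. rewrite <- HX, <- HY in Hcyc.
  rewrite Tgen_upper in HX by assumption. rewrite Tgen_lower in HY by assumption.
  set (j1 := (sigma g j + 2)%Z) in *. set (j2 := (sigma g (j - 1) - 1)%Z) in *.
  replace (sigma g j + 1)%Z with (j1 - 1)%Z in Hcyc by (unfold j1; ring).
  assert (HX' : X = side_pt (j1 - 1) (upper x + d)).
  { rewrite HX. replace j1 with (j1 - 1 + 1)%Z at 1 by ring.
    rewrite side_pt_shift. f_equal. ring. }
  assert (HY' : Y = side_pt (j2 - 1) (lower x + d)).
  { rewrite HY. replace j2 with (j2 - 1 + 1)%Z at 1 by ring.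
    rewrite side_pt_shift. f_equal. ring. }
  pose proof (a_range (j1 - 1)). pose proof (a_range j1). pose proof (a_range (j1 + 1)).
  pose proof (a_range (j2 - 1)). pose proof (a_range j2). pose proof (a_range (j2 + 1)).
  assert (E1 : a j1 <= upper x -> fA g A X = Tgen g j1 X).
  { intros. rewrite HX. apply fA_side_pt. lra. }
  assert (E2 : upper x < a j1 -> fA g A X = Tgen g (j1 - 1) X).
  { intros. rewrite HX'. apply fA_side_pt. rewrite Z.sub_add. lra. }
  assert (E3 : a j2 < lower x -> fA_minus g A Y = Tgen g j2 Y).
  { intros. rewrite HY. apply fA_minus_side_pt. lra. }
  assert (E4 : lower x <= a j2 -> fA_minus g A Y = Tgen g (j2 - 1) Y).
  { intros. rewrite HY'. apply fA_minus_side_pt. rewrite Z.sub_add. lra. }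
  destruct (Rle_dec (a j1) (upper x)) as [Hu | Hu]; cbn [fst snd].
  - assert (a j2 < lower x) by (apply Rnot_le_lt; intros ?; apply Hexcl; lra).
    split; [| discriminate]. repeat split; try lra.
    + rewrite E1 by assumption. now rewrite <- HX.
    + rewrite E3, <- Hcyc by assumption. now rewrite <- HX.
  - apply Rnot_le_lt in Hu. rewrite E2 in * by assumption.
    destruct (Rle_lt_dec (lower x) (a j2)) as [Hl | Hl].
    + split; [| intros; assumption]. repeat split; try lra.
      * now rewrite <- HY.
      * rewrite E4 by assumption. now rewrite <- HY.
    + exfalso. apply Hne. now rewrite E3 by assumption.
Qed.

(** Orbits that never met would make the iterates of [next_state] an infinite run. *)
Lemma orbits_meet (X Y : C) (s : Z * R) : tracks s X Y ->
  exists m, Nat.iter (S m) (fA g A) X = Nat.iter (S m) (fA_minus g A) Y.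
Proof.
  intros H0. apply NNPP. intros Hno.
  set (st n := Nat.iter n next_state s).
  assert (Hst : forall n, tracks (st n) (Nat.iter n (fA g A) X) (Nat.iter n (fA_minus g A) Y)).
  { induction n as [| n IH]; [exact H0 |].
    apply tracks_next in IH; [exact (proj1 IH) |].
    intros E. apply Hno. now exists n. }
  assert (Hlow : forall n, goes_upper (st n) = false ->
    lower (snd (st n)) <= a (sigma g (fst (st n) - 1) - 1)%Z).
  { intros n. apply (tracks_next _ _ _ (Hst n)). intros E. apply Hno. now exists n. }
  apply (no_infinite_run (fun n => fst (st n)) (fun n => snd (st n))
    (fun n => goes_upper (st n))).
  - intros n. apply Hst.
  - intros n Hw. change (st (S n)) with (next_state (st n)).
    unfold next_state. rewrite Hw. cbn [fst snd]. repeat split.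
    unfold goes_upper in Hw. destruct Rle_dec; [assumption | discriminate].
  - intros n Hw. pose proof (Hlow n Hw). change (st (S n)) with (next_state (st n)).
    unfold next_state. rewrite Hw. cbn [fst snd]. now repeat split.
Qed.

End Partition.

End Geometry.

Theorem theorem1p1 (g : nat) (hg : (2 <= g)%nat) (A : Z -> C)
  (Aper : forall i : Z, A (i + Nsides g)%Z = A i)
  (Ain : forall i : Z, arc_oo (Ppt g i) (Qpt g i) (A i)) :
  forall i : Z, (1 <= i <= Nsides g)%Z ->
    exists m k : nat, (1 <= m)%nat /\ (1 <= k)%nat /\
      Nat.iter m (fA g A) (Tgen g i (A i)) =
      Nat.iter k (fA_minus g A) (Tgen g (i - 1) (A i)).
Proof.
  intros i _.
  set (P j x := - beta g < x < beta g - step g /\ A j = side_pt g j x).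
  set (a j := epsilon (inhabits 0) (P j)).
  assert (Ha : forall j, P j (a j)).
  { intros j. apply epsilon_spec. exact (arc_PQ g hg j (A j) (Ain j)). }
  assert (Aper' : forall j m, A (j + m * Nsides g)%Z = A j).
  { intros j m. induction m as [| m IH | m IH] using Z.peano_ind.
    - f_equal. ring.
    - rewrite <- IH, <- (Aper (j + m * _)%Z). f_equal. ring.
    - rewrite <- IH, <- (Aper (j + Z.pred m * _)%Z). f_equal. unfold Z.pred. ring. }
  (* The chosen angle is unique, since I is shorter than a full turn, and so inherits the period of
     A. *)
  assert (aper : forall j m, a (j + m * Nsides g)%Z = a j).
  { intros j m. pose proof (Ha j) as [H1 H2]. pose proof (Ha (j + m * Nsides g)%Z) as [H3 H4].
    rewrite Aper', H2, (side_pt_period g hg) in H4.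
    pose proof (beta_bounds g hg). pose proof (step_bounds g hg). pose proof PI_RGT_0.
    apply cis_inj in H4; lra. }
  destruct (orbits_meet g hg A a (fun j => proj1 (Ha j)) (fun j => proj2 (Ha j)) aper
    (Tgen g i (A i)) (Tgen g (i - 1) (A i)) (i, a i)) as [m Hm].
  { pose proof (Ha i) as [H1 H2]. unfold tracks. cbn [fst snd]. now rewrite <- H2. }
  exists (S m), (S m). repeat split; try lia. exact Hm.
Qed.
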